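(* Let $P=\{p_1,\ldots,p_m\}$ be a finite poset and let $\mathcal{A}$ assign to each $p_i$ a non-empty subset $A_i\subseteq[n]$. For every integer $k\ge1$, the ring $R/\mathcal{L}(P,\mathcal{A})^k$ is the quotient of $T/\mathcal{L}(P^k,\mathcal{A}^k)$ by a regular sequence of variable differences; that is, there is a regular sequence on $T/\mathcal{L}(P^k,\mathcal{A}^k)$ consisting of differences of two variables of $T$ such that the quotient of $T/\mathcal{L}(P^k,\mathcal{A}^k)$ by this sequence is isomorphic to $R/\mathcal{L}(P,\mathcal{A})^k$.
   Context: $n$ is a positive integer, $[n]=\{1,\ldots,n\}$, $\mathbf{K}$ is a field; $p_i<p_j$ implies $i<j$. Here $R=\mathbf{K}[X_{p_i,a}\mid 1\le i\le m,\ a\in A_i]$. A map $f:P\to[n]$ is isotone if $p\le q$ implies $f(p)\le f(q)$. For a finite poset $Q$ and a map $\mathcal{B}$ assigning to each $q\in Q$ a non-empty subset $\mathcal{B}_q\subseteq[n]$, $\mathrm{Hom}(Q,\mathcal{B})$ is the set of isotone maps $f:Q\to[n]$ with $f(q)\in\mathcal{B}_q$ for all $q$; it is assumed that $\mathrm{Hom}(P,\mathcal{A})\neq\emptyset$. Set $U_f:=\prod_{q\in Q}X_{q,f(q)}$ and let $\mathcal{L}(Q,\mathcal{B})$ be the ideal generated by all $U_f$ with $f\in\mathrm{Hom}(Q,\mathcal{B})$. $P^k$ is the poset with underlying set $\{p_{i,j}\mid 1\le i\le m,\ 1\le j\le k\}$ and order $p_{i_1,j_1}\le p_{i_2,j_2}$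 iff $p_{i_1}\le p_{i_2}$ and $j_1\le j_2$ (so $P^k\cong P\times[k]$). The map $\mathcal{A}^k$ assigns $A_i$ to $p_{i,j}$ for all $i,j$. $T=\mathbf{K}[X_{p_{i,j},a}\mid 1\le i\le m,\ 1\le j\le k,\ a\in A_i]$, and $\mathcal{L}(P^k,\mathcal{A}^k)$ is regarded as an ideal of $T$. *)

(* Defs.v *)
From HB Require Import structures.
From mathcomp Require Import all_boot all_order all_algebra.
From mathcomp Require Import boolp.
From mathcomp.multinomials Require Export mpoly.

Set Implicit Arguments.
Unset Strict Implicit.
Unset Printing Implicit Defensive.

Import Order.TTheory GRing.Theory.
Local Open Scope ring_scope.
Local Open Scope quotient_scope.

(* MathComp's idealr is restricted to proper ideals given by a boolean
   predicate; the ideals below are arbitrary (possibly the whole ring). *)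
Record ideal (R : comPzRingType) := Ideal {
  ideal_mem :> R -> Prop;
  ideal0 : ideal_mem 0;
  idealD : forall x y, ideal_mem x -> ideal_mem y -> ideal_mem (x + y);
  idealMl : forall a x, ideal_mem x -> ideal_mem (a * x)
}.

Section GeneratedIdeal.
Variables (R : comPzRingType) (S : R -> Prop).

Definition ideal_gen_mem (x : R) : Prop :=
  exists2 c : seq (R * R),
    (forall ag, ag \in c -> S ag.2) & x = \sum_(ag <- c) ag.1 * ag.2.

Fact ideal_gen0 : ideal_gen_mem 0.
Proof. by exists [::]; rewrite ?big_nil. Qed.

Fact ideal_genD x y :
  ideal_gen_mem x -> ideal_gen_mem y -> ideal_gen_mem (x + y).
Proof.
move=> [c cS ->] [e eS ->]; exists (c ++ e); last by rewrite big_cat.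
by move=> ag; rewrite mem_cat => /orP[/cS | /eS].
Qed.

Fact ideal_genMl a x : ideal_gen_mem x -> ideal_gen_mem (a * x).
Proof.
move=> [c cS ->]; exists [seq (a * ag.1, ag.2) | ag <- c].
  by move=> _ /mapP[ag /cS agS ->].
by rewrite big_map mulr_sumr; apply: eq_bigr => ag _; rewrite mulrA.
Qed.

Definition ideal_gen : ideal R := Ideal ideal_gen0 ideal_genD ideal_genMl.

End GeneratedIdeal.

Definition ideal_pow (R : comPzRingType) (I : ideal R) (k : nat) : ideal R :=
  ideal_gen (fun x => exists2 y : 'I_k -> R,
    (forall i, I (y i)) & x = \prod_(i < k) y i).

Section QuotientRing.
Variables (R : comPzRingType) (I : ideal R).

Definition ideal_pred : {pred R} := fun x => `[< I x >].

Lemma ideal_predE x : (x \in ideal_pred) = `[< I x >]. Proof. by []. Qed.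

Fact ideal_pred_zmod : zmod_closed ideal_pred.
Proof.
split=> [|x y]; rewrite !ideal_predE; first exact/asboolP/ideal0.
move=> /asboolP Ix /asboolP Iy; apply/asboolP/idealD => //.
by rewrite -mulN1r; apply: idealMl.
Qed.
HB.instance Definition _ := GRing.isZmodClosed.Build R ideal_pred ideal_pred_zmod.

Definition quot_ring : Type := {ideal_quot ideal_pred}.
HB.instance Definition _ := GRing.Zmodule.on quot_ring.
HB.instance Definition _ := EqQuotient.on quot_ring.

Definition proj (x : R) : quot_ring := \pi_quot_ring x.

Lemma proj_eq x y : proj x = proj y <-> I (x - y).
Proof.
by rewrite -(asboolE (I (x - y))) -ideal_predE Quotient.idealrBE; split=> /eqP.
Qed.

Lemma proj_repr (u : quot_ring) : proj (repr u) = u. Proof. exact: reprK. Qed.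

Lemma proj_surj (u : quot_ring) : exists x, u = proj x.
Proof. by exists (repr u); rewrite proj_repr. Qed.

Definition quot_one : quot_ring := proj 1.
Definition quot_mul (u v : quot_ring) : quot_ring := proj (repr u * repr v).

Fact quot_mulE x y : quot_mul (proj x) (proj y) = proj (x * y).
Proof.
apply/proj_eq; set x' := repr _; set y' := repr _.
have Ix : I (x' - x) by apply/proj_eq; rewrite proj_repr.
have Iy : I (y' - y) by apply/proj_eq; rewrite proj_repr.
have -> : x' * y' - x * y = y' * (x' - x) + x * (y' - y).
  by rewrite !mulrBr addrA (mulrC y' x') (mulrC y' x) subrK.
by apply: idealD; apply: idealMl.
Qed.

Fact projD x y : proj (x + y) = proj x + proj y.
Proof. exact: (raddfD (\pi_{ideal_quot ideal_pred})). Qed.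

Fact quot_mulA : associative quot_mul.
Proof.
move=> u v w.
have [x ->] := proj_surj u; have [y ->] := proj_surj v.
have [z ->] := proj_surj w.
by rewrite !quot_mulE mulrA.
Qed.

Fact quot_mulC : commutative quot_mul.
Proof. by move=> u v; rewrite /quot_mul mulrC. Qed.

Fact quot_mul1 : left_id quot_one quot_mul.
Proof. by move=> u; have [x ->] := proj_surj u; rewrite quot_mulE mul1r. Qed.

Fact quot_mulDl : left_distributive quot_mul +%R.
Proof.
move=> u v w.
have [x ->] := proj_surj u; have [y ->] := proj_surj v.
have [z ->] := proj_surj w.
by rewrite -projD !quot_mulE mulrDl projD.
Qed.

HB.instance Definition _ := GRing.Zmodule_isComPzRing.Build quot_ring
  quot_mulA quot_mulC quot_mul1 quot_mulDl.

Fact proj_zmod_morphism : zmod_morphism proj.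
Proof. exact: (raddfB (\pi_{ideal_quot ideal_pred})). Qed.
HB.instance Definition _ :=
  GRing.isZmodMorphism.Build R quot_ring proj proj_zmod_morphism.

Fact proj_monoid_morphism : monoid_morphism proj.
Proof. by split=> [|x y]; rewrite -?quot_mulE. Qed.
HB.instance Definition _ :=
  GRing.isMonoidMorphism.Build R quot_ring proj proj_monoid_morphism.

End QuotientRing.

Definition ideal_seq (R : comPzRingType) (r : seq R) : ideal R :=
  ideal_gen (fun x => x \in r).

(* As usual, a regular sequence is required to generate a proper ideal. *)
Definition regular_seq (R : comPzRingType) (r : seq R) : Prop :=
  (forall i x, (i < size r)%N ->
     ideal_seq (take i r) (r`_i * x) -> ideal_seq (take i r) x) /\
  ~ ideal_seq r 1.

Section IsotoneMaps.
Variables (n : nat) (disp : Order.disp_t) (Q : finPOrderType disp).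
Variable B : Q -> {set 'I_n}.

Definition isoHom : {set {ffun Q -> 'I_n}} :=
  [set f : {ffun Q -> 'I_n} | [forall q, f q \in B q] &&
     [forall x, forall y, (x <= y)%O ==> (f x <= f y)%N]].

Lemma isoHom_mem (f : {ffun Q -> 'I_n}) : f \in isoHom -> forall q, f q \in B q.
Proof. by rewrite inE => /andP[/forallP]. Qed.

Definition var : Type := {v : Q * 'I_n | v.2 \in B v.1}.
HB.instance Definition _ := Finite.on var.

Definition mkvar (q : Q) (a : 'I_n) (a_in : a \in B q) : var :=
  exist (fun v : Q * 'I_n => v.2 \in B v.1) (q, a) a_in.

End IsotoneMaps.

Section IsotoneIdeals.
Variables (K : fieldType) (n : nat) (disp : Order.disp_t).
Variables (Q : finPOrderType disp) (B : Q -> {set 'I_n}).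

Definition polyring : comNzRingType := {mpoly K[#|{: var B}|]}.

Definition X (v : var B) : polyring := 'X_(enum_rank v).

Definition cst_poly (c : K) : polyring := c%:MP.

Definition U (f : {ffun Q -> 'I_n}) (hf : f \in isoHom B) : polyring :=
  \prod_(q : Q) X (mkvar (isoHom_mem hf q)).

Definition L : ideal polyring :=
  ideal_gen (fun u =>
    exists (f : {ffun Q -> 'I_n}) (hf : f \in isoHom B), u = U hf).

End IsotoneIdeals.

Arguments X K {n disp Q B} v.

(* p_(i,j) is encoded as the pair (p_i, j); *p is the product of posets with
   the componentwise order. *)
Definition Ppow disp (P : finPOrderType disp) (k : nat) :
    finPOrderType (Order.prod_display disp Order.OrdinalOrder.ord_display) :=
  (P *p 'I_k)%type.

Definition Apow n disp (P : finPOrderType disp) (A : P -> {set 'I_n}) (k : nat) :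
  Ppow P k -> {set 'I_n} := fun q => A (q : P * 'I_k).1.

Arguments Apow {n disp P} A k _.

(* Main.v *)
From HB Require Import structures.
Require Import Defs.
From mathcomp Require Import all_boot all_order all_algebra.
From mathcomp Require Import boolp zify.

Set Implicit Arguments.
Unset Strict Implicit.
Unset Printing Implicit Defensive.

Import Order.TTheory GRing.Theory.
Local Open Scope ring_scope.

(** Fix a copy [j0] of [P] inside [P^k].  The regular sequence consists of all
    differences [X_(p,j,a) - X_(p,j0,a)] with [j <> j0], in any order.

    Killing the first few of them amounts to a substitution that identifies
    some variables of [T] inside their fibres over [(p, a)].  The image of
    [L(P^k, A^k)] under such a substitution is still a monomial ideal, generated
    by the images of the [U_F] ([L_diff_relabel]).  So each step of regularity
    asks whether [x - y] is a nonzerodivisor modulo a monomial ideal [I], for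
    two distinct variables [x], [y] over the same [(p, a)].  An associated prime
    of [I] containing [x - y] is generated by variables, hence contains both [x]
    and [y]; it therefore suffices that [x u, y u \in I] imply [u \in I] for
    every monomial [u] ([mono_ideal_regular], proved on coefficients).

    This last implication is where isotone maps enter.  Let [U_F] divide [x u]
    and [U_G] divide [y u].  Since [P^k] is [P] times a chain, the chain can be
    cut at the last [j] where both [F] and [G] are at most [a] at [(p, j)]; the
    map [H] equal to [min F G] up to the cut and to [max F G] beyond it is
    isotone.  Over [(p, a)], [H] takes the value [a] only where both [F] and [G]
    do; over any other [(q, b)], the positions where [H] takes the value [b] all
    lie where [F] does, or all where [G] does.  Both statements concern sets of
    positions, so they survive every identification inside the fibres, and they
    bound the degrees of [U_H] by those of [u] ([isoHom_mnms_criterion]).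

    When all copies are identified with [P], the [U_F] become the products
    [U_(f_1) ... U_(f_k)] with [f_1 <= ... <= f_k].  These generate
    [L(P, A)^k], because sorting the values of [k] isotone maps pointwise yields
    such a chain with the same product ([ideal_pow_L]). *)

(** * Ideals, quotients and ring morphisms *)

Definition image_set (T T' : Type) (f : T -> T') (S : T -> Prop) (y : T') :=
  exists2 x, S x & y = f x.

Section Ideals.
Variable R : comPzRingType.

Lemma ideal_genI (S : R -> Prop) x : S x -> ideal_gen S x.
Proof.
move=> Sx; exists [:: (1, x)]; last by rewrite big_seq1 mul1r.
by move=> ag; rewrite inE => /eqP ->.
Qed.

Lemma ideal_sum (J : ideal R) (T : eqType) (s : seq T) (F : T -> R) :
  {in s, forall t, J (F t)} -> J (\sum_(t <- s) F t).
Proof.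
by move=> JF; rewrite big_seq; elim/big_rec: _ => [|t x ts Jx];
  [apply: ideal0 | apply: idealD => //; apply: JF].
Qed.

Lemma ideal_gen_min (S : R -> Prop) (J : ideal R) :
  (forall x, S x -> J x) -> forall x, ideal_gen S x -> J x.
Proof.
by move=> SJ x [c cS ->]; apply: ideal_sum => ag /cS/SJ; apply: idealMl.
Qed.

Lemma ideal_gen_ext (S1 S2 : R -> Prop) :
  (forall x, S1 x <-> S2 x) -> forall x, ideal_gen S1 x <-> ideal_gen S2 x.
Proof.
by move=> S12 x; split; move: x; apply: ideal_gen_min => x /S12;
  apply: ideal_genI.
Qed.

Lemma idealB (J : ideal R) x y : J x -> J y -> J (x - y).
Proof. by move=> Jx Jy; rewrite -mulN1r; apply/idealD/idealMl. Qed.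

Lemma ideal_congr (J : ideal R) x y : J (x - y) -> J x <-> J y.
Proof.
move=> Jxy; split=> [Jx|Jy]; last by rewrite -(subrK y x); apply: idealD.
by rewrite -(subKr x y); apply: idealB.
Qed.

Lemma proj0 (J : ideal R) x : proj J x = 0 <-> J x.
Proof. by rewrite -(rmorph0 (proj J)) proj_eq subr0. Qed.

Lemma ideal_gen_mul (S1 S2 : R -> Prop) (J : ideal R) :
    (forall x y, S1 x -> S2 y -> J (x * y)) ->
  forall x y, ideal_gen S1 x -> ideal_gen S2 y -> J (x * y).
Proof.
move=> SJ x y [c cS ->] [e eS ->]; rewrite mulr_suml.
apply: ideal_sum => ag /cS S1g; rewrite mulr_sumr.
apply: ideal_sum => bh /eS S2h; rewrite mulrACA.
by apply: idealMl; apply: SJ.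
Qed.

Lemma ideal_pow_gen (S : R -> Prop) k x :
  ideal_pow (ideal_gen S) k x <->
  ideal_gen (fun z => exists2 y : 'I_k -> R,
    (forall i, S (y i)) & z = \prod_(i < k) y i) x.
Proof.
split; move: x; apply: ideal_gen_min => _ [y Sy ->]; last first.
  by apply: ideal_genI; exists y => // i; apply: ideal_genI.
elim: k y Sy => [|k IHk] y Sy.
  apply: ideal_genI; exists (fun=> 0); first by case.
  by rewrite !big_ord0.
rewrite big_ord_recl.
have := IHk _ (fun i => Sy (lift ord0 i)); move: (Sy ord0).
move: (y _) (\prod_(_ < _) _) => {Sy y IHk}; apply: ideal_gen_mul.
move=> x _ Sx [y Sy ->]; apply: ideal_genI.
exists (fun i => if unlift ord0 i is Some j then y j else x) => [i|].
  by case: unliftP.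
rewrite big_ord_recl unlift_none; congr (_ * _).
by apply: eq_bigr => i _; rewrite liftK.
Qed.

End Ideals.

Section Preimage.
Variables R R' : comPzRingType.

Lemma ideal_gen_preim (f : {rmorphism R -> R'}) (S : R -> Prop)
    (J : ideal R') :
  (forall x, S x -> J (f x)) -> forall x, ideal_gen S x -> J (f x).
Proof.
move=> SJ x [c cS ->]; rewrite rmorph_sum; apply: ideal_sum => ag /cS/SJ Jg.
by rewrite rmorphM; apply: idealMl.
Qed.

End Preimage.

Section Morphisms.
Variables R R' : comPzRingType.

(** If [g] is a section of [f] modulo the relations [D], then passing to the
    quotient by [D] is the same as applying [f]: membership in the ideal
    generated by [S] and [D] can be tested after [f], where [D] is gone. *)
Lemma ideal_gen_retract (f : {rmorphism R -> R'}) (g : {rmorphism R' -> R})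
    (S D : R -> Prop) :
    (forall d, D d -> f d = 0) -> (forall x, ideal_gen D (x - g (f x))) ->
  forall x, ideal_gen (fun y => S y \/ D y) x
            <-> ideal_gen (image_set f S) (f x).
Proof.
move=> fD gf x; set J := ideal_gen (fun y => S y \/ D y).
have DJ y : ideal_gen D y -> J y.
  by apply: ideal_gen_min => d Dd; apply: ideal_genI; right.
split=> [|Jfx].
  apply: ideal_gen_preim => {}x [Sx|/fD ->].
    by apply: ideal_genI; exists x.
  exact: ideal0.
apply/(ideal_congr (DJ _ (gf x))); move: {x}(f x) Jfx.
apply: ideal_gen_preim => _ [x Sx ->] /=.
by apply/(ideal_congr (DJ _ (gf x)))/ideal_genI; left.
Qed.

Lemma quot_lift (J : ideal R) (f : {rmorphism R -> R'}) :
    (forall x, J x -> f x = 0) ->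
  {g : {rmorphism quot_ring J -> R'} | forall x, g (proj J x) = f x}.
Proof.
move=> Jf0; pose g (u : quot_ring J) := f (repr u).
have gE x : g (proj J x) = f x.
  apply/eqP; rewrite -subr_eq0 -rmorphB; apply/eqP/Jf0/proj_eq.
  exact: proj_repr.
have gB : zmod_morphism g.
  move=> u v; have [x ->] := proj_surj u; have [y ->] := proj_surj v.
  by rewrite -rmorphB !gE rmorphB.
have gM : monoid_morphism g.
  split=> [|u v]; first by rewrite -(rmorph1 (proj J)) gE rmorph1.
  have [x ->] := proj_surj u; have [y ->] := proj_surj v.
  by rewrite -rmorphM !gE rmorphM.
pose gZ := GRing.isZmodMorphism.Build _ _ g gB.
pose gR := GRing.isMonoidMorphism.Build _ _ g gM.
pose G : {rmorphism quot_ring J -> R'} := HB.pack g gZ gR.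
by exists G.
Qed.

End Morphisms.

Lemma ideal_seq_proj (R : comPzRingType) (J : ideal R) (s : seq R) x :
  ideal_seq [seq proj J d | d <- s] (proj J x)
  <-> ideal_gen (fun y => J y \/ y \in s) x.
Proof.
set Js := ideal_gen (fun y => J y \/ y \in s).
have JJs y : J y -> Js y by move=> Jy; apply: ideal_genI; left.
split=> [[c cs xE]|]; last first.
  apply: ideal_gen_preim => {}x [/proj0 Jx |xs].
    by rewrite [X in ideal_mem _ X]Jx; apply: ideal0.
  by apply: ideal_genI; apply: map_f.
have /choice[h hE] (u : quot_ring J) :
    exists x, u \in [seq proj J d | d <- s] -> x \in s /\ u = proj J x.
  have [/mapP[d ds ->]|_] := boolP (u \in _); first by exists d.
  by exists 0.
have xc : Js (x - \sum_(ag <- c) repr ag.1 * h ag.2).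
  apply/JJs/proj_eq; rewrite xE raddf_sum /= big_seq [RHS]big_seq.
  apply: eq_bigr => ag /cs/hE[_ gE]; rewrite rmorphM.
  by rewrite /= proj_repr -gE.
apply/(ideal_congr xc)/ideal_sum => ag /cs/hE[hs _]; apply: idealMl.
by apply: ideal_genI; right.
Qed.

(** * Regular differences modulo monomial ideals *)

Section MonomialIdeals.
Variables (K : fieldType) (N : nat).
Implicit Types (G : 'X_{1..N} -> Prop) (m g : 'X_{1..N}) (x : {mpoly K[N]})
  (i j : 'I_N).

Definition multiple_of G m : Prop := exists2 g, G g & (g <= m)%MM.

Definition mono_ideal G : ideal {mpoly K[N]} :=
  ideal_gen (image_set (fun g => 'X_[g]) G).

Lemma lepm_add m1 m2 n1 n2 :
  (m1 <= n1)%MM -> (m2 <= n2)%MM -> (m1 + m2 <= n1 + n2)%MM.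
Proof.
move=> /mnm_lepP le1 /mnm_lepP le2; apply/mnm_lepP => l.
by rewrite !mnmDE leq_add.
Qed.

Lemma multiple_of_le G m1 m2 :
  (m1 <= m2)%MM -> multiple_of G m1 -> multiple_of G m2.
Proof. by move=> le12 [g Gg /lepm_trans]; exists g; auto. Qed.

Lemma mono_idealP G x :
  mono_ideal G x <-> (forall m, m \in msupp x -> multiple_of G m).
Proof.
split=> [|Gx]; last first.
  rewrite (mpolyE x); apply: ideal_sum => m /Gx[g Gg /submK <-].
  rewrite mpolyXD -mul_mpolyC mulrA; apply: idealMl.
  by apply: ideal_genI; exists g.
case=> c cG -> {x}; rewrite big_seq.
elim/big_rec: _ => [|[a y] x /cG[g Gg /= ->] Gx] m; first by rewrite msupp0.
move=> /msuppD_le; rewrite mem_cat => /orP[|]; last exact: Gx.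
move=> /msuppM_le/allpairsP[[m1 m2]] /= [_ + ->].
by rewrite msuppX inE => /eqP ->; exists g => //; rewrite lem_addl.
Qed.

(** The guard records that [m - U_(i) + U_(j)] is truncated, hence meaningless,
    when ['X_i] does not divide ['X_[m]]. *)
Lemma mcoeff_diff_mul x i j m : i != j ->
  (('X_i - 'X_j) * x)@_(m + U_(j)) =
    (if (0 < m i)%N then x@_(m - U_(i) + U_(j)) else 0) - x@_m.
Proof.
move=> neq_ij; rewrite mulrBl mcoeffB ![_ * x]mulrC [(m + _)%MM]addmC mcoeffMX.
congr (_ - _).
case: ifPn => [mi_gt0|].
  have -> : (U_(j) + m = U_(i) + (m - U_(i) + U_(j)))%MM.
    apply/mnmP => l; rewrite !(mnmDE, mnmBE, mnm1E).
    by have [<-|_] := eqVneq i l; lia.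
  by rewrite mcoeffMX.
rewrite -eqn0Ngt => /eqP mi0; apply/eqP; rewrite mcoeff_eq0.
rewrite (perm_mem (msuppMX _ _)); apply/mapP => -[m' _ /mnmP/(_ i)].
by rewrite !(mnmDE, mnm1E) eqxx mi0 eq_sym (negPf neq_ij).
Qed.

(** Trading ['X_i] for ['X_j], one walks along the monomials of [x]: if
    ['X_[m] * 'X_j] does not occur in [('X_i - 'X_j) * x], its coefficient
    cancelled, so ['X_[m] * 'X_j / 'X_i] occurs in [x] too.  The degree in
    ['X_i] drops at each move, so the walk ends inside the ideal. *)
Lemma msupp_multiple G x i j m : i != j ->
    mono_ideal G (('X_i - 'X_j) * x) -> m \in msupp x ->
  exists e, multiple_of G (m + U_(j) *+ e)%MM.
Proof.
move=> neq_ij /mono_idealP Gx; have [d] := ubnP (m i).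
elim: d m => // d IHd m; rewrite ltnS => mi_le mx.
have [/Gx|] := boolP ((m + U_(j))%MM \in msupp (('X_i - 'X_j) * x)).
  by exists 1%N; rewrite mulm1n.
rewrite -mcoeff_eq0 mcoeff_diff_mul //; case: ifPn => [mi_gt0|_]; last first.
  by rewrite sub0r oppr_eq0 mcoeff_eq0 mx.
rewrite subr_eq0 => /eqP x_m.
have [||e] := IHd (m - U_(i) + U_(j))%MM.
- rewrite !(mnmDE, mnmBE, mnm1E) eqxx eq_sym (negPf neq_ij); lia.
- by rewrite mcoeff_msupp x_m -mcoeff_msupp.
move=> Gm; exists e.+1; apply: multiple_of_le Gm.
rewrite mulmS addmA; apply: lepm_add (lepm_refl _).
by apply: lepm_add (lepm_refl _); apply: lem_subr.
Qed.

(** The criterion on two variables extends to their powers: both [m + U_(i)] and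
    [m + U_(j)] satisfy the hypotheses with a smaller [a + b], so they are
    multiples of [G], and hence so is [m]. *)
Lemma multiple_of_descent G i j :
    (forall m, multiple_of G (m + U_(i)) -> multiple_of G (m + U_(j)) ->
       multiple_of G m) ->
  forall a b m, multiple_of G (m + U_(i) *+ a) ->
    multiple_of G (m + U_(j) *+ b) -> multiple_of G m.
Proof.
move=> crit a b m; have [d] := ubnP (a + b).
elim: d a b m => // d IHd [|a] [|b] m; rewrite ?mulm0n ?addm0 //= => ab Ga Gb.
apply: crit.
- apply: (IHd a b.+1); first lia; first by rewrite -addmA -mulmS.
  apply: multiple_of_le Gb.
  by apply: lepm_add; rewrite ?lepm_refl ?lem_addr.
- apply: (IHd a.+1 b); first lia; last by rewrite -addmA -mulmS.
  apply: multiple_of_le Ga.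
  by apply: lepm_add; rewrite ?lepm_refl ?lem_addr.
Qed.

(** Every monomial of [x] is moved into the ideal by a power of ['X_j] and,
    since the difference is antisymmetric in [i] and [j], by a power of
    ['X_i]. *)
Lemma mono_ideal_regular G i j x : i != j ->
    (forall m, multiple_of G (m + U_(i)) -> multiple_of G (m + U_(j)) ->
       multiple_of G m) ->
  mono_ideal G (('X_i - 'X_j) * x) -> mono_ideal G x.
Proof.
move=> neq_ij crit Gx; apply/mono_idealP => m mx.
have [b Gb] := msupp_multiple neq_ij Gx mx.
have Gx' : mono_ideal G (('X_j - 'X_i) * x).
  by have := idealMl (-1) Gx; rewrite mulN1r -mulNr opprB.
have [a Ga] := msupp_multiple (contra_neq esym neq_ij) Gx' mx.
exact: multiple_of_descent crit a b m Ga Gb.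
Qed.

End MonomialIdeals.

(** * Splicing isotone maps on a product with a chain *)

Section Isotone.
Variables (n : nat) (disp : Order.disp_t) (Q : finPOrderType disp).
Variable B : Q -> {set 'I_n}.
Implicit Type F : {ffun Q -> 'I_n}.

Lemma isoHomP F :
  reflect ((forall q, F q \in B q) /\
           (forall x y, (x <= y)%O -> (F x <= F y)%N))
          (F \in isoHom B).
Proof.
rewrite inE; apply: (iffP andP) => -[FB Fle]; split; last 1 first.
- apply/forallP => x; apply/forallP => y; apply/implyP; exact: Fle.
- exact/forallP.
- by move=> x y; have /forallP/(_ y)/implyP := forallP Fle x.
- exact/forallP.
Qed.

Definition isoHom_var F (hF : F \in isoHom B) (q : Q) : var B :=
  mkvar (isoHom_mem hF q).

Lemma isoHom_var_eq F G (hF : F \in isoHom B) (hG : G \in isoHom B) q :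
  F q = G q -> isoHom_var hF q = isoHom_var hG q.
Proof. by move=> FG; apply: val_inj; rewrite /= FG. Qed.

Variables (N : nat) (t : var B -> 'I_N).

(** The exponent of [U_F] after the variables have been renamed by [t], which
    may identify some of them. *)
Definition isoHom_mnm F (hF : F \in isoHom B) : 'X_{1..N} :=
  (\sum_(q : Q) U_(t (isoHom_var hF q)))%MM.

Definition isoHom_mnms (g : 'X_{1..N}) : Prop :=
  exists (F : {ffun Q -> 'I_n}) (hF : F \in isoHom B), g = isoHom_mnm hF.

Lemma isoHom_mnmE F (hF : F \in isoHom B) i :
  isoHom_mnm hF i = #|[set q | t (isoHom_var hF q) == i]|.
Proof.
rewrite mnm_sumE -sum1dep_card [RHS]big_mkcond; apply: eq_bigr => q _.
by rewrite mnm1E; case: eqP.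
Qed.

Lemma leq_isoHom_mnm F G (hF : F \in isoHom B) (hG : G \in isoHom B) i :
    (forall q, t (isoHom_var hF q) = i -> F q = G q) ->
  (isoHom_mnm hF i <= isoHom_mnm hG i)%N.
Proof.
move=> FG; rewrite !isoHom_mnmE; apply/subset_leq_card/subsetP => q.
by rewrite !inE => /eqP tF; rewrite -(isoHom_var_eq hF hG (FG q tF)) tF.
Qed.

End Isotone.

Section Power.
Variables (n : nat) (disp : Order.disp_t) (P : finPOrderType disp).
Variables (A : P -> {set 'I_n}) (k : nat).
Local Notation Q := (Ppow P k).
Local Notation B := (Apow A k).
Implicit Types (F G : {ffun Q -> 'I_n}) (p : P) (a b : 'I_n) (j : 'I_k).

Lemma le_Ppow (x y : Q) :
  (x <= y)%O = ((x : P * 'I_k).1 <= (y : P * 'I_k).1)%O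
               && ((x : P * 'I_k).2 <= (y : P * 'I_k).2)%N.
Proof. by []. Qed.

(** [min F G] on the initial segment of the chain where both maps are at most
    [a] at [p], and [max F G] beyond. *)
Definition splice F G p a : {ffun Q -> 'I_n} :=
  [ffun q : P * 'I_k =>
    if ((F (p, q.2) <= a) && (G (p, q.2) <= a))%N
    then if (F q <= G q)%N then F q else G q
    else if (F q <= G q)%N then G q else F q].

(** Both [min F G] and [max F G] are isotone, and the cut depends on the chain
    coordinate only, so one passes from the former to the latter going up. *)
Lemma splice_isoHom F G p a :
  F \in isoHom B -> G \in isoHom B -> splice F G p a \in isoHom B.
Proof.
move=> /isoHomP[FB Fle] /isoHomP[GB Gle]; apply/isoHomP; split=> [q|x y le_xy].
  by rewrite ffunE; case: ifP => _; case: ifP.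
rewrite !ffunE; move: (Fle _ _ le_xy) (Gle _ _ le_xy).
have le_p : @Order.le _ Q (p, (x : P * 'I_k).2) (p, (y : P * 'I_k).2).
  by move: le_xy; rewrite !le_Ppow lexx => /andP[].
move: (Fle _ _ le_p) (Gle _ _ le_p).
by do 4![case: ifP => ?]; lia.
Qed.

(** Below the cut, [min F G = a] with [F, G <= a] forces [F = G = a]; beyond it,
    [max F G > a]. *)
Lemma splice_eq F G p a j : splice F G p a (p, j) = a ->
  F (p, j) = a /\ G (p, j) = a.
Proof.
rewrite ffunE /=; move: (F (p, j)) (G (p, j)) => f g.
move=> /(congr1 val) H; split; apply: val_inj; move: H => /=;
by do 2![case: ifP => ?]; lia.
Qed.

(** Suppose that [b] is reached at [j1] through [G] only and at [j2] through [F]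
    only.  If [j1 <= j2], then [F < b = G] at [j1] and [F = b < G] at [j2], so
    the splice is the maximum at [j1] but the minimum at [j2], which lies
    further up.  The case [j2 <= j1] is alike. *)
Lemma splice_fibre F G p a q b : F \in isoHom B -> G \in isoHom B ->
  (forall j, splice F G p a (q, j) = b -> splice F G p a (q, j) = F (q, j)) \/
  (forall j, splice F G p a (q, j) = b -> splice F G p a (q, j) = G (q, j)).
Proof.
move=> /isoHomP[_ Fle] /isoHomP[_ Gle]; set H := splice F G p a.
have [/forallP HF|] :=
    boolP [forall j, (H (q, j) == b) ==> (H (q, j) == F (q, j))].
  by left=> j Hb; have := HF j; rewrite Hb eqxx => /eqP.
rewrite negb_forall => /existsP[j1]; rewrite negb_imply => /andP[/eqP H1 F1].
have [/forallP HG|] :=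
    boolP [forall j, (H (q, j) == b) ==> (H (q, j) == G (q, j))].
  by right=> j Hb; have := HG j; rewrite Hb eqxx => /eqP.
rewrite negb_forall => /existsP[j2]; rewrite negb_imply => /andP[/eqP H2 G2].
exfalso; have mono (E : {ffun Q -> 'I_n}) x j j' :
    (forall x y, (x <= y)%O -> (E x <= E y)%N) ->
    (j <= j')%N -> (E (x, j) <= E (x, j'))%N.
  by move=> Ele jj; apply: Ele; rewrite le_Ppow lexx.
have := leq_total j1 j2.
move: F1 G2 H1 H2; rewrite /H !ffunE /= -!val_eqE /=.
move=> F1 G2 /(congr1 val) /= + /(congr1 val) /= + /orP[] le12.
all: have := mono F q _ _ Fle le12; have := mono G q _ _ Gle le12.
all: have := mono F p _ _ Fle le12; have := mono G p _ _ Gle le12.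
all: move: F1 G2.
all: by do 4![case: ifP => ?]; rewrite -?val_eqE /=; lia.
Qed.

End Power.

Section Criterion.
Variables (n : nat) (disp : Order.disp_t) (P : finPOrderType disp).
Variables (A : P -> {set 'I_n}) (k : nat).
Local Notation Q := (Ppow P k).
Local Notation B := (Apow A k).

(** The variables that are identified in the end: those over the same [(p, a)],
    whatever the chain coordinate. *)
Definition fibre (v : var B) : P * 'I_n :=
  (((val v).1 : P * 'I_k).1, (val v).2).

Variables (N : nat) (t : var B -> 'I_N) (phi : 'I_N -> P * 'I_n).
Hypothesis t_fibre : forall v, phi (t v) = fibre v.

Lemma splice_mnm F G (hF : F \in isoHom B) (hG : G \in isoHom B) p a
    (hH : splice F G p a \in isoHom B) i :
  (isoHom_mnm t hH i <= isoHom_mnm t hF i)%N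
  \/ (isoHom_mnm t hH i <= isoHom_mnm t hG i)%N.
Proof.
case Ephi: (phi i) => [q b].
have tE j' q' : t (isoHom_var hH (q', j')) = i ->
    q' = q /\ splice F G p a (q', j') = b.
  move=> ti; have := t_fibre (isoHom_var hH (q', j')).
  by rewrite ti Ephi => -[-> ->].
have [HF|HG] := splice_fibre p a q b hF hG; [left|right];
  by apply: leq_isoHom_mnm => -[q' j'] /tE[-> ]; auto.
Qed.

Lemma splice_mnm_at F G (hF : F \in isoHom B) (hG : G \in isoHom B) p a
    (hH : splice F G p a \in isoHom B) i : phi i = (p, a) ->
  (isoHom_mnm t hH i <= isoHom_mnm t hF i)%N
  /\ (isoHom_mnm t hH i <= isoHom_mnm t hG i)%N.
Proof.
move=> Ephi; have tE q : t (isoHom_var hH q) = i ->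
    [/\ splice F G p a q = a, F q = a & G q = a].
  case: q => [q j] ti; have := t_fibre (isoHom_var hH (q, j)).
  rewrite ti Ephi => -[Ep Ea]; rewrite -Ep in Ea *.
  by have [] := splice_eq (esym Ea).
by split; apply: leq_isoHom_mnm => q /tE[-> Fa Ga].
Qed.

(** If [U_F] divides ['X_i * u] and [U_G] divides ['X_j * u], the splice [H] of
    [F] and [G] at the common fibre [(p, a)] of [i] and [j] satisfies
    [deg_i U_H <= deg_i U_G <= deg_i u], likewise [deg_j U_H <= deg_j U_F <=
    deg_j u], and elsewhere its degree is bounded by that of [F] or of [G]. *)
Lemma isoHom_mnms_criterion i j m : i != j -> phi i = phi j ->
    multiple_of (isoHom_mnms t) (m + U_(i))%MM ->
    multiple_of (isoHom_mnms t) (m + U_(j))%MM ->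
  multiple_of (isoHom_mnms t) m.
Proof.
move=> neq_ij; case Ei: (phi i) => [p a] Ej.
move=> [_ [F [hF ->]] /mnm_lepP Fm] [_ [G [hG ->]] /mnm_lepP Gm].
have hH := splice_isoHom p a hF hG.
exists (isoHom_mnm t hH); first by exists (splice F G p a), hH.
apply/mnm_lepP => l; move: (Fm l) (Gm l); rewrite !mnmDE !mnm1E.
have [<-|neq_il] := eqVneq i l.
  rewrite eq_sym (negPf neq_ij) => _; rewrite addn0; apply: leq_trans.
  by have [] := splice_mnm_at hF hG hH Ei.
have [<-|neq_jl] := eqVneq j l.
  rewrite addn0 => + _; apply: leq_trans.
  by have [] := splice_mnm_at hF hG hH (esym Ej).
rewrite !addn0.
by case: (splice_mnm hF hG hH l) => H F' G'; apply: leq_trans H _.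
Qed.

End Criterion.

(** * Sorting a family of isotone maps *)

(** The [j]-th smallest value is at most [z] iff more than [j] values are, and
    that count decreases when the values grow. *)
Lemma le_nth_sort disp (T : orderType disp) (I : Type) (f g : I -> T)
    (r : seq I) x y j :
    (forall i, f i <= g i)%O -> (j < size r)%N ->
  (nth x (sort <=%O (map f r)) j <= nth y (sort <=%O (map g r)) j)%O.
Proof.
move=> le_fg lt_j; set z := nth y _ j.
apply: nth_count_le; first exact: sort_le_sorted.
rewrite (permP (permEl (perm_sort _ _))).
have: (j < count (<= z)%O (map g r))%N.
  rewrite -(permP (permEl (perm_sort <=%O _))) ltnNge; apply/negP => le_j.
  suff: (z < z)%O by rewrite ltxx.
  apply: nth_count_gt; first exact: sort_le_sorted.
  by rewrite le_j size_sort size_map.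
move/leq_trans; apply; rewrite !count_map; apply: sub_count => i /=.
exact: le_trans.
Qed.

Section Sort.
Variables (n : nat) (disp : Order.disp_t) (P : finPOrderType disp).
Variables (A : P -> {set 'I_n}) (k : nat).
Local Notation Q := (Ppow P k).
Local Notation B := (Apow A k).

(** The default [f q.2 q.1] is out of reach; it only avoids assuming ['I_n]
    inhabited. *)
Definition sort_maps (f : 'I_k -> {ffun P -> 'I_n}) : {ffun Q -> 'I_n} :=
  [ffun q : P * 'I_k =>
    nth (f q.2 q.1) (sort <=%O [seq f i q.1 | i <- enum 'I_k]) q.2].

Lemma sort_maps_isoHom f :
  (forall i, f i \in isoHom A) -> sort_maps f \in isoHom B.
Proof.
move=> /(_ _)/isoHomP hf; apply/isoHomP; split=> [q|x y].
  have: sort_maps f q \in [seq f i (q : P * 'I_k).1 | i <- enum 'I_k].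
    rewrite -(mem_sort <=%O) ffunE mem_nth // size_sort size_map.
    by rewrite size_enum_ord.
  by case/mapP=> i _ ->; have [] := hf i.
rewrite le_Ppow => /andP[le_p le_j].
apply: (@leq_trans (sort_maps f ((x : P * 'I_k).1, (y : P * 'I_k).2))).
  rewrite !ffunE /=; set s := sort _ _.
  rewrite (set_nth_default (f (y : P * 'I_k).2 (x : P * 'I_k).1) (f _ _));
    last by rewrite size_sort size_map size_enum_ord.
  have lt_s (j : 'I_k) : val j \in [pred i | (i < size s)%N].
    by rewrite inE size_sort size_map size_enum_ord; apply: ltn_ord.
  exact: (le_sorted_leq_nth _ (sort_le_sorted _) (lt_s _) (lt_s _) le_j).
have le_f i : (f i (x : P * 'I_k).1 <= f i (y : P * 'I_k).1)%O.
  by have [_] := hf i; apply.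
rewrite !ffunE /=; apply: (le_nth_sort _ _ le_f).
by rewrite size_enum_ord; apply: ltn_ord.
Qed.

Lemma sort_maps_prod (R : comPzRingType) f (Y : P -> 'I_n -> R) :
  \prod_(q : Q) Y (q : P * 'I_k).1 (sort_maps f q)
  = \prod_(i < k) \prod_(p : P) Y p (f i p).
Proof.
rewrite exchange_big.
transitivity (\prod_(p : P) \prod_(j < k) Y p (sort_maps f (p, j))).
  by rewrite pair_bigA; apply: eq_bigr => -[].
apply: eq_bigr => p _.
have [j0 _|no_j] := pickP [pred j : 'I_k | true]; last by rewrite !big_pred0.
set s := sort <=%O [seq f i p | i <- enum 'I_k].
have ss : size s = k by rewrite size_sort size_map size_enum_ord.
transitivity (\prod_(a <- s) Y p a); last first.
  by rewrite (perm_big _ (permEl (perm_sort _ _))) big_map big_enum.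
rewrite (big_nth (f j0 p)) ss big_mkord; apply: eq_bigr => j _.
by rewrite ffunE /=; congr (Y p _); apply: set_nth_default; rewrite ss.
Qed.

End Sort.

(** * Relabelling the variables of an ideal of isotone maps *)

Lemma mpoly_rmorph_ext (K : comNzRingType) (N : nat) (S : comPzRingType)
    (f g : {rmorphism {mpoly K[N]} -> S}) :
    (forall c, f c%:MP = g c%:MP) -> (forall i, f 'X_i = g 'X_i) ->
  f =1 g.
Proof.
move=> fgC fgX x; rewrite (mpolyE x) !rmorph_sum; apply: eq_bigr => m _.
rewrite -mul_mpolyC mpolyXE_id !rmorphM fgC !rmorph_prod; congr (_ * _).
by apply: eq_bigr => i _; rewrite !rmorphXn /= fgX.
Qed.

Section Relabel.
Variables (K : fieldType) (n : nat) (disp : Order.disp_t).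
Variables (Q : finPOrderType disp) (B : Q -> {set 'I_n}).
Variables (N : nat) (t : var B -> 'I_N).

Definition relabel : {mpoly K[#|{: var B}|]} -> {mpoly K[N]} :=
  mmap (@mpolyC N K) (fun i => 'X_(t (enum_val i))).
HB.instance Definition _ := GRing.RMorphism.on relabel.

Lemma relabelX v : relabel (X K v) = 'X_(t v).
Proof. by rewrite /relabel /X mmapX mmap1U enum_rankK. Qed.

Lemma relabelC c : relabel c%:MP = c%:MP.
Proof. by rewrite /relabel mmapC. Qed.

Lemma relabelU F (hF : F \in isoHom B) :
  relabel (U K hF) = 'X_[isoHom_mnm t hF].
Proof.
rewrite /U rmorph_prod /isoHom_mnm.
rewrite (big_morph _ (@mpolyXD N K) (@mpolyX0 N K)).
by apply: eq_bigr => q _; apply: relabelX.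
Qed.

Definition var_diff (d : var B * var B) : polyring K B := X K d.1 - X K d.2.

(** Provided that the differences in [D] relate each variable [v] to the
    representative [s (t v)] of its class, the quotient by them is the renaming
    by [t], under which the generators of [L] become monomials. *)
Lemma L_diff_relabel (s : 'I_N -> var B) (D : seq (var B * var B)) :
    {in D, forall d, t d.1 = t d.2} ->
    (forall v, ideal_seq (map var_diff D) (X K v - X K (s (t v)))) ->
  forall x, ideal_gen (fun y => L K B y \/ y \in map var_diff D) x
            <-> mono_ideal K (isoHom_mnms t) (relabel x).
Proof.
move=> tD sD x.
pose Lgens (u : polyring K B) :=
  exists (F : {ffun Q -> 'I_n}) (hF : F \in isoHom B), u = U K hF.
pose h (i : 'I_N) : polyring K B := X K (s i).
pose g : {rmorphism {mpoly K[N]} -> polyring K B} :=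
  mmap (@mpolyC _ K) h.
have gf y : ideal_seq (map var_diff D) (y - g (relabel y)).
  apply/proj_eq.
  pose pD := proj (ideal_seq (map var_diff D)).
  apply: (@mpoly_rmorph_ext _ _ _ pD (pD \o g \o relabel)) => [c|i] /=.
    by rewrite relabelC [mmap _ _ _]mmapC.
  apply/proj_eq; rewrite -[i]enum_valK -/(X K _) relabelX.
  by rewrite [mmap _ _ _]mmapX mmap1U.
have fD d : d \in map var_diff D -> relabel d = 0.
  by case/mapP=> -[v w] /tD /= tvw ->; rewrite rmorphB /= !relabelX tvw subrr.
have := @ideal_gen_retract _ _ relabel g Lgens _ fD gf x.
have : forall y, image_set relabel Lgens y
         <-> image_set (fun m => 'X_[m]) (isoHom_mnms t) y.
  move=> y; split=> [[_ [F [hF ->]] ->]|[_ [F [hF ->]] ->]].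
    by exists (isoHom_mnm t hF); [exists F, hF | rewrite relabelU].
  by exists (U K hF); [exists F, hF | rewrite relabelU].
move=> /ideal_gen_ext/(_ (relabel x)) <- <-.
split; move: x; apply: ideal_gen_min => x [Lx|Dx].
- move: x Lx; apply: ideal_gen_min => x Lx.
  by apply: ideal_genI; left.
- by apply: ideal_genI; right.
- by apply: ideal_genI; left; apply: ideal_genI.
- by apply: ideal_genI; right.
Qed.

End Relabel.

(** * Polarizing the powers *)

Section Power.
Variables (K : fieldType) (n : nat) (disp : Order.disp_t).
Variables (P : finPOrderType disp) (A : P -> {set 'I_n}) (k : nat).
Local Notation Q := (Ppow P k).
Local Notation B := (Apow A k).

Definition forget (v : var B) : var A :=
  mkvar (q := (fibre v).1) (a := (fibre v).2) (valP v).

(** [X_(p,a)] without a proof that [a] is admissible at [p], so that products of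
    variables can be reindexed freely. *)
Definition value_var (p : P) (a : 'I_n) : polyring K A :=
  if insub (p, a) is Some v then X K (v : var A) else 1.

Lemma value_varE (v : var A) : value_var (val v).1 (val v).2 = X K v.
Proof. by rewrite /value_var -surjective_pairing valK. Qed.

Lemma U_value_var f (hf : f \in isoHom A) :
  U K hf = \prod_(p : P) value_var p (f p).
Proof.
by apply: eq_bigr => p _; rewrite -(value_varE (isoHom_var hf p)).
Qed.

Lemma mnm_value_var F (hF : F \in isoHom B) :
  'X_[isoHom_mnm (enum_rank \o forget) hF] =
  \prod_(q : Q) value_var (q : P * 'I_k).1 (F q).
Proof.
rewrite -relabelU rmorph_prod; apply: eq_bigr => q _.
by rewrite [LHS]relabelX; apply/esym/(value_varE (forget (isoHom_var hF q))).
Qed.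

(** A product of [k] generators [U_(f_i)] is the image of [U_F] for [F] the
    pointwise sort of the [f_i]; conversely the image of [U_F] is the product of
    the [U] of its restrictions to the copies of [P]. *)
Lemma ideal_pow_L x :
  ideal_pow (L K A) k x
  <-> mono_ideal K (isoHom_mnms (enum_rank \o forget)) x.
Proof.
apply: (iff_trans (ideal_pow_gen _ _ _)); apply: ideal_gen_ext => {}x; split.
  case=> y /choice[f /(_ _)/cid-/all_sig[hf yE]] ->.
  exists (isoHom_mnm (enum_rank \o forget) (sort_maps_isoHom hf)).
    by exists (sort_maps f), (sort_maps_isoHom hf).
  rewrite mnm_value_var sort_maps_prod; apply: eq_bigr => i _.
  by rewrite yE U_value_var.
case=> _ [F [hF ->]] ->.
pose f (j : 'I_k) := [ffun p : P => F (p, j)].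
have hf j : f j \in isoHom A.
  have /isoHomP[FB Fle] := hF.
  apply/isoHomP; split=> [p|p1 p2 le_p]; rewrite !ffunE; first exact: FB.
  by apply: Fle; rewrite le_Ppow le_p leqnn.
exists (fun j => U K (hf j)) => [j|]; first by exists (f j), (hf j).
rewrite mnm_value_var.
transitivity (\prod_(p : P) \prod_(j < k) value_var p (F (p, j))).
  by rewrite pair_bigA; apply: eq_bigr => -[].
rewrite exchange_big; apply: eq_bigr => j _; rewrite U_value_var.
by apply: eq_bigr => p _; rewrite ffunE.
Qed.

Variable j0 : 'I_k.

Definition lift_var (v : var A) : var B :=
  mkvar (q := ((val v).1, j0) : Q) (a := (val v).2) (valP v).

Definition base (v : var B) : var B := lift_var (forget v).

Lemma lift_varK : cancel lift_var forget.
Proof. by move=> v; apply: val_inj; apply/esym/surjective_pairing. Qed.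

Lemma base_idem v : base (base v) = base v.
Proof. by rewrite /base lift_varK. Qed.

Definition identify (l : seq (var B)) (v : var B) : var B :=
  if v \in l then base v else v.

Definition nonbase : seq (var B) := [seq v <- enum {: var B} | base v != v].

Definition base_pairs (l : seq (var B)) : seq (var B * var B) :=
  [seq (v, base v) | v <- l].

Lemma L_base_pairsE (l : seq (var B)) x :
    {subset l <= nonbase} ->
  ideal_gen (fun y => L K B y \/
                      y \in map (@var_diff K _ _ _ B) (base_pairs l)) x
  <-> mono_ideal K (isoHom_mnms (enum_rank \o identify l))
        (relabel (enum_rank \o identify l) x).
Proof.
move=> l_off; apply: (L_diff_relabel (s := enum_val)) => [d|v].
  case/mapP=> v lv -> /=; congr enum_rank; rewrite /identify lv.
  case: ifP => //.
  by move/l_off; rewrite mem_filter base_idem eqxx.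
rewrite [enum_val _]enum_rankK /identify; case: ifP => lv.
  by apply: ideal_genI; apply/mapP; exists (v, base v) => //; apply: map_f.
by rewrite subrr; apply: ideal0.
Qed.

Lemma L_all_base_pairsE x :
  ideal_gen (fun y => L K B y \/
                      y \in map (@var_diff K _ _ _ B) (base_pairs nonbase)) x
  <-> ideal_pow (L K A) k (relabel (enum_rank \o forget) x).
Proof.
apply: iff_trans (iff_sym (ideal_pow_L _)).
apply: (L_diff_relabel (s := lift_var \o enum_val)) => [d|v].
  by case/mapP=> v lv -> /=; rewrite lift_varK.
rewrite (_ : (_ \o _) _ = base v); last by rewrite /= enum_rankK.
have [->|neq] := eqVneq (base v) v.
  by rewrite subrr; apply: ideal0.
apply: ideal_genI; apply/mapP; exists (v, base v) => //; apply: map_f.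
by rewrite mem_filter neq mem_enum.
Qed.

(** The variables [v] and [base v] are still distinct after the identifications
    made along [l], and they lie in the same fibre: splicing applies. *)
Lemma base_diff_regular (l : seq (var B)) v x :
    {subset l <= nonbase} -> v \in nonbase -> v \notin l ->
    mono_ideal K (isoHom_mnms (enum_rank \o identify l))
      (relabel (enum_rank \o identify l) (var_diff K (v, base v) * x)) ->
  mono_ideal K (isoHom_mnms (enum_rank \o identify l))
    (relabel (enum_rank \o identify l) x).
Proof.
move=> l_off v_off v_l; set t := enum_rank \o identify l.
have tv : t v = enum_rank v by rewrite /t /= /identify (negPf v_l).
have tb : t (base v) = enum_rank (base v).
  by rewrite /t /= /identify base_idem if_same.
have t_fibre w : fibre (enum_val (t w)) = fibre w.
  by rewrite /t /= enum_rankK /identify; case: ifP.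
have neq_t : t v != t (base v).
  rewrite tv tb (inj_eq enum_rank_inj) eq_sym.
  by move: v_off; rewrite mem_filter => /andP[].
rewrite rmorphM rmorphB /= !relabelX; apply: mono_ideal_regular => // m.
apply: (isoHom_mnms_criterion (phi := fun i => fibre (enum_val i))) => //.
by rewrite !t_fibre.
Qed.

Definition base_diffs : seq (quot_ring (L K B)) :=
  map (proj (L K B)) (map (@var_diff K _ _ _ B) (base_pairs nonbase)).

Lemma base_diffs_regular : (0 < #|P|)%N -> regular_seq base_diffs.
Proof.
move=> /card_gt0P[p0 _]; split; last first.
  (* A generator dividing 1 would have degree 0 in every variable, including
     the one that F selects at (p0, j0). *)
  move/(ideal_seq_proj _ _ 1)/(L_base_pairsE _ (fun _ => id)).
  rewrite rmorph1 => /mono_idealP/(_ 0%MM); rewrite msupp1 inE eqxx.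
  move=> /(_ isT)[_ [F [hF ->]] /mnm_lepP].
  set v := isoHom_var hF (p0, j0).
  move/(_ (enum_rank (identify nonbase v))).
  rewrite mnm0E isoHom_mnmE leqNgt => /negP; apply; apply/card_gt0P.
  by exists (p0, j0); rewrite inE.
move=> i u; rewrite !size_map => lt_i; have [x ->] := proj_surj u.
have /hasP[v0 _ _] : has predT nonbase.
  by rewrite has_predT; apply: leq_ltn_trans lt_i.
rewrite -!map_take (nth_map 0) ?size_map // (nth_map (v0, v0)) ?size_map //.
rewrite (nth_map v0) // -rmorphM.
move=> /ideal_seq_proj/L_base_pairsE H; apply/ideal_seq_proj/L_base_pairsE.
  by move=> v /mem_take.
apply: base_diff_regular (H _) => [v /mem_take|||v /mem_take] //.
  exact: mem_nth.
have: uniq nonbase by rewrite filter_uniq ?enum_uniq.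
rewrite -{1}(cat_take_drop i nonbase) (drop_nth v0) // cat_uniq /=.
by rewrite negb_or => /and3P[_ /andP[]].
Qed.

Lemma forgetK_relabel (y : polyring K A) :
  relabel (enum_rank \o forget) (relabel (enum_rank \o lift_var) y) = y.
Proof.
pose f := relabel (K := K) (enum_rank \o forget).
pose g := relabel (K := K) (enum_rank \o lift_var).
apply: (@mpoly_rmorph_ext _ _ _ (f \o g) idfun) => [c|i] /=.
  by rewrite /f /g !relabelC.
have fX v : f (X K v) = X K (forget v) by apply: relabelX.
have gX v : g (X K v) = X K (lift_var v) by apply: relabelX.
suff: f (g (X K (enum_val i))) = X K (enum_val i) by rewrite /X enum_valK.
by rewrite gX fX lift_varK.
Qed.

Lemma quot_base_diffs_iso :
  exists phi : {rmorphism quot_ring (ideal_seq base_diffs) ->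
                          quot_ring (ideal_pow (L K A) k)},
    bijective phi /\
    (forall x, phi (proj (ideal_seq base_diffs) (proj (L K B) x))
               = proj (ideal_pow (L K A) k) (relabel (enum_rank \o forget) x)).
Proof.
set I := ideal_pow (L K A) k.
pose f : {rmorphism polyring K B -> quot_ring I} :=
  proj I \o relabel (enum_rank \o forget).
have f0 x : f x = 0 <-> ideal_seq base_diffs (proj (L K B) x).
  apply: (iff_trans (proj0 _ _)).
  apply: (iff_trans (iff_sym (L_all_base_pairsE _))).
  exact: iff_sym (ideal_seq_proj _ _ _).
have [|g gE] := @quot_lift _ _ (L K B) f.
  by move=> x /proj0 Lx; apply/f0; rewrite Lx; apply: ideal0.
have [|phi phiE] := @quot_lift _ _ (ideal_seq base_diffs) g.
  by move=> u; have [x ->] := proj_surj u; rewrite gE => /f0.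
exists phi; split=> [|x]; last by rewrite phiE gE.
have phi0 w : phi w = 0 -> w = 0.
  have [u ->] := proj_surj w.
  have [x ->] := proj_surj u; rewrite phiE gE => fx0.
  by apply/proj0/f0.
have phi_inj : injective phi by apply: raddf_inj.
pose h (w : quot_ring I) : quot_ring (ideal_seq base_diffs) :=
  proj _ (proj (L K B) (relabel (enum_rank \o lift_var) (repr w))).
have hK : cancel h phi.
  move=> w; apply: (etrans (phiE _)); rewrite gE /= forgetK_relabel.
  exact: proj_repr.
by exists h => // u; apply: phi_inj; rewrite hK.
Qed.

End Power.

Theorem corollary5p6 (K : fieldType) (n m : nat) (disp : Order.disp_t)
  (P : finPOrderType disp) (p : 'I_m -> P) (A : P -> {set 'I_n})
  (n_gt0 : (0 < n)%N) (m_gt0 : (0 < m)%N)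
  (p_bij : bijective p)
  (p_lin : forall i j : 'I_m, (p i < p j)%O -> (i < j)%N)
  (A_neq0 : forall q : P, A q != set0)
  (Hom_neq0 : isoHom A != set0)
  (k : nat) (k_gt0 : (0 < k)%N) :
  exists s : seq (var (Apow A k) * var (Apow A k)),
    let r := [seq proj (L K (Apow A k)) (X K v.1 - X K v.2) | v <- s] in
    regular_seq r /\
    exists phi : {rmorphism quot_ring (ideal_seq r) ->
                            quot_ring (ideal_pow (L K A) k)},
      bijective phi /\
      (forall c : K,
        phi (proj (ideal_seq r) (proj (L K (Apow A k)) (cst_poly (Apow A k) c)))
        = proj (ideal_pow (L K A) k) (cst_poly A c)).
Proof.
pose j0 := Ordinal k_gt0; exists (base_pairs j0 (nonbase A j0)) => r.
have -> : r = base_diffs K A j0 by rewrite /base_diffs -map_comp.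
split.
  by apply: base_diffs_regular; apply/card_gt0P; exists (p (Ordinal m_gt0)).
have [phi [phi_bij phiE]] := quot_base_diffs_iso K A j0.
by exists phi; split=> // c; rewrite phiE relabelC.
Qed.
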